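(* Let $M=U\Sigma V^\top\in\mathbb R^{m\times n}$ have rank $r$ (compact SVD), and let $S\in\mathbb R^{m\times s}$, $P\in\mathbb R^{n\times c}$ be selection matrices such that $\operatorname{rank}(S^\top U)=r$ and $\operatorname{rank}(V^\top P)=r$. Let $\Phi_r(A)=AP\,(S^\top A P)_r^\dagger\, S^\top A$. Then $$\Phi_r(M+E)-M=\mathcal I_{T_M}^{S,P}E+O(\|E\|^2).$$ Consequently, $$\|\Phi_r(M+E)-M\|\le\|\mathcal I_{T_M}^{S,P}E\|+O(\|E\|^2).$$ Here $\|\cdot\|$ is any fixed norm on $\mathbb R^{m\times n}$, and $O(\|E\|^2)$ denotes a term bounded in norm by $C\|E\|^2$ for all sufficiently small $E\in\mathbb R^{m\times n}$, with $C$ depending only on $M,S,P,r$ and the norm.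
   Context: Compact SVD: $M=U\Sigma V^\top$ with $U\in\mathbb R^{m\times r}$, $V\in\mathbb R^{n\times r}$, $U^\top U=V^\top V=I_r$, $\Sigma=\operatorname{diag}(\sigma_1,\dots,\sigma_r)$, $\sigma_1\ge\cdots\ge\sigma_r>0$, $r\ge1$. Selection matrices: the columns of $S\in\mathbb R^{m\times s}$ and $P\in\mathbb R^{n\times c}$ are distinct columns of $I_m$ and $I_n$ respectively, so $S^\top S=I_s$, $P^\top P=I_c$. $X^\dagger$ is the Moore–Penrose pseudoinverse. $X_r$ denotes the best rank-$r$ approximation of $X$ obtained by truncating the SVD (unique when $\sigma_r(X)>\sigma_{r+1}(X)$, which holds for $X=S^\top(M+E)P$ with $E$ small; otherwise any choice). $(S^\top AP)_r^\dagger$ means the pseudoinverse of $(S^\top AP)_r$. Put $\Pi_U=U(S^\top U)^\dagger S^\top$ and $\Pi_V=P(V^\top P)^\dagger V^\top$. The sampling-induced oblique tangent projector is the linear operator $\mathcal I_{T_M}^{S,P}E=\Pi_U E+E\Pi_V-\Pi_U E\Pi_V$ on $\mathbb R^{m\times n}$. *)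

(* Defs.v *)
From HB Require Import structures.
From mathcomp Require Import all_boot all_order all_algebra.
From mathcomp Require Import all_classical all_reals all_analysis.
From mathcomp Require Import ring lra.

Set Implicit Arguments.
Unset Strict Implicit.
Unset Printing Implicit Defensive.

Import Order.TTheory GRing.Theory Num.Theory.
Import numFieldNormedType.Exports.

Local Open Scope ring_scope.

(* Nonnegativity and [N 0 = 0] follow from the three fields. *)
Record is_norm (R : realType) (V : lmodType R) (N : V -> R) : Prop := IsNorm {
  is_norm_eq0 : forall x, N x = 0 -> x = 0;
  is_normZ : forall a x, N (a *: x) = `|a| * N x;
  is_normD : forall x y, N (x + y) <= N x + N y }.

Definition selection_mx (R : realType) (m s : nat) (S : 'M[R]_(m, s)) : Prop :=
  exists2 f : 'I_s -> 'I_m, injective f & S = colsub f 1%:M.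

(* [k] is the rank of [X]; [k = 0] is allowed, so that [X = 0] has an SVD. *)
Definition compact_svd (R : realType) (p q k : nat) (X : 'M[R]_(p, q))
    (U : 'M[R]_(p, k)) (d : 'rV[R]_k) (V : 'M[R]_(q, k)) : Prop :=
  [/\ U^T *m U = 1%:M, V^T *m V = 1%:M,
      forall i j : 'I_k, (i <= j)%N -> d 0 j <= d 0 i,
      forall i, 0 < d 0 i
    & X = U *m diag_mx d *m V^T].

(* [Y] is a possible value of [X_r].  If [X] has rank at most [r] then [Y = X]; *)
(* when the r-th and (r+1)-th singular values of [X] coincide there may be      *)
(* several such [Y].                                                            *)
Definition svd_truncation (R : realType) (p q r : nat) (X Y : 'M[R]_(p, q)) :
    Prop :=
  exists k (U : 'M[R]_(p, k)) (d : 'rV[R]_k) (V : 'M[R]_(q, k)),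
    compact_svd X U d V /\
    Y = \sum_(i < k | (i < r)%N) d 0 i *: (col i U *m (col i V)^T).

(* [tr] is any choice of [X |-> X_r]. *)
Definition truncation_rule (R : realType) (p q r : nat)
    (tr : 'M[R]_(p, q) -> 'M[R]_(p, q)) : Prop :=
  forall X, svd_truncation r X (tr X).

Definition penrose (R : realType) (p q : nat) (X : 'M[R]_(p, q))
    (Y : 'M[R]_(q, p)) : Prop :=
  [/\ X *m Y *m X = X, Y *m X *m Y = Y,
      (X *m Y)^T = X *m Y & (Y *m X)^T = Y *m X].

(* The default value [0] is never used: see [pinvP] below. *)
Definition pinv (R : realType) (p q : nat) (X : 'M[R]_(p, q)) : 'M[R]_(q, p) :=
  xget 0 [set Y | penrose X Y]%classic.

Definition Phi (R : realType) (m n s c : nat)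
    (tr : 'M[R]_(s, c) -> 'M[R]_(s, c)) (S : 'M[R]_(m, s)) (P : 'M[R]_(n, c))
    (A : 'M[R]_(m, n)) : 'M[R]_(m, n) :=
  A *m P *m pinv (tr (S^T *m A *m P)) *m (S^T *m A).

Definition Pi_U (R : realType) (m s r : nat) (S : 'M[R]_(m, s))
    (U : 'M[R]_(m, r)) : 'M[R]_m :=
  U *m pinv (S^T *m U) *m S^T.

Definition Pi_V (R : realType) (n c r : nat) (P : 'M[R]_(n, c))
    (V : 'M[R]_(n, r)) : 'M[R]_n :=
  P *m pinv (V^T *m P) *m V^T.

Definition oblique_tangent_proj (R : realType) (m n s c r : nat)
    (S : 'M[R]_(m, s)) (P : 'M[R]_(n, c)) (U : 'M[R]_(m, r)) (V : 'M[R]_(n, r))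
    (E : 'M[R]_(m, n)) : 'M[R]_(m, n) :=
  Pi_U S U *m E + E *m Pi_V P V - Pi_U S U *m E *m Pi_V P V.

Lemma penrose_uniq (R : realType) (p q : nat) (X : 'M[R]_(p, q)) Y Z :
  penrose X Y -> penrose X Z -> Y = Z.
Proof.
move=> [XYX YXY XYT YXT] [XZX ZXZ XZT ZXT].
have e1 : X *m Y = X *m Z.
  have h : X *m Y = (X *m Z) *m (X *m Y) by rewrite mulmxA XZX.
  by rewrite -XYT h trmx_mul XYT XZT mulmxA XYX.
have e2 : Y *m X = Z *m X.
  have h : Y *m X = (Y *m X) *m (Z *m X) by rewrite -mulmxA (mulmxA X) XZX.
  by rewrite -YXT h trmx_mul YXT ZXT -mulmxA (mulmxA X) XYX.
by rewrite -YXY e2 -mulmxA e1 mulmxA.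
Qed.

Section SvdExistence.
Variable R : realType.

Let dot q (u v : 'rV[R]_q) : R := (u *m v^T) 0 0.

Let dotE q (u v : 'rV[R]_q) : dot u v = \sum_j u 0 j * v 0 j.
Proof. by rewrite /dot mxE; apply: eq_bigr => j _; rewrite mxE. Qed.

Let dotC q (u v : 'rV[R]_q) : dot u v = dot v u.
Proof. by rewrite !dotE; apply: eq_bigr => j _; rewrite mulrC. Qed.

Let dotDl q (u v w : 'rV[R]_q) : dot (u + v) w = dot u w + dot v w.
Proof. by rewrite /dot mulmxDl mxE. Qed.

Let dotZl q a (u w : 'rV[R]_q) : dot (a *: u) w = a * dot u w.
Proof. by rewrite /dot -scalemxAl mxE. Qed.

Let dotDr q (u v w : 'rV[R]_q) : dot w (u + v) = dot w u + dot w v.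
Proof. by rewrite dotC dotDl !(dotC _ w). Qed.

Let dotZr q a (u w : 'rV[R]_q) : dot w (a *: u) = a * dot w u.
Proof. by rewrite dotC dotZl dotC. Qed.

Let dot_ge0 q (u : 'rV[R]_q) : 0 <= dot u u.
Proof. by rewrite dotE sumr_ge0// => j _; rewrite -expr2 sqr_ge0. Qed.

Let dot_eq0 q (u : 'rV[R]_q) : dot u u = 0 -> u = 0.
Proof.
rewrite dotE => /eqP; rewrite psumr_eq0; last first.
  by move=> j _; rewrite -expr2 sqr_ge0.
move=> /allP h; apply/rowP => j; rewrite mxE.
by have := h j (mem_index_enum j); rewrite /= mulf_eq0 orbb => /eqP.
Qed.

Let dot_continuous q p (X : 'M[R]_(q, p)) :
  continuous (fun w : 'rV[R]_q => dot (w *m X) (w *m X)).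
Proof.
under eq_fun do rewrite dotE.
have cX j : continuous (fun w : 'rV[R]_q => (w *m X) 0 j).
  under eq_fun do rewrite mxE.
  apply: (@continuous_big R _ +%R) => [|i _ w].
    exact: add_continuous.
  by apply: continuousM; [exact: coord_continuous|exact: cst_continuous].
apply: (@continuous_big R _ +%R) => [|j _ w]; first exact: add_continuous.
by apply: continuousM; exact: cX.
Qed.

Let top_singular p q (X : 'M[R]_(p, q)) : X != 0 ->
  exists (u : 'rV[R]_p) (v : 'rV[R]_q) (a : R),
  [/\ 0 < a, dot u u = 1, dot v v = 1, v *m X^T = a *: u & u *m X = a *: v] /\
  forall w : 'rV[R]_q, dot (w *m X^T) (w *m X^T) <= a ^+ 2 * dot w w.
Proof.
move=> X0.
pose f (w : 'rV[R]_q) := dot (w *m X^T) (w *m X^T).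
pose A : set 'rV[R]_q := [set w | dot w w = 1]%classic.
have /existsP[i /existsP[j Xij]] : [exists i, exists j, X i j != 0].
  apply: contra_neqT X0; rewrite negb_exists => /forallP h.
  apply/matrixP => i j; rewrite mxE; have := h i; rewrite negb_exists.
  by move=> /forallP/(_ j); rewrite negbK => /eqP.
have dj : dot (delta_mx 0 j) (delta_mx 0 j) = 1 :> R.
  by rewrite /dot trmx_delta mul_delta_mx mxE !eqxx.
have A0 : (A !=set0)%classic by exists (delta_mx 0 j).
have cA : compact A.
  apply: bounded_closed_compact.
    exists 1; split; first exact: num_real.
    move=> y y1 w /= Aw; apply: (le_trans _ (ltW y1)).
    rewrite [leLHS]/Num.norm/= mx_normrE; apply/bigmax_leP; split => // -[a b] _ /=.
    rewrite -(@ler_pXn2r _ 2) ?nnegrE// expr1n.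
    rewrite real_normK ?num_real// -Aw dotE (bigD1 b)//= (ord1 a) expr2.
    by rewrite lerDl sumr_ge0// => c _; rewrite -expr2 sqr_ge0.
  have -> : A = ((fun w => dot (w *m 1%:M) (w *m 1%:M)) @^-1` [set 1])%classic.
    by apply/seteqP; split => w /=; rewrite mulmx1.
  apply: preimage_closed; last exact: closed_eq.
  by move=> w _; exact: dot_continuous.
have cf : ({within A, continuous f})%classic.
  exact/continuous_subspaceT/dot_continuous.
have [v /set_mem/= Av vmax] := compact_EVT_max A0 cA cf.
have {}vmax w : f w <= f v * dot w w.
  have [w0|w0] := eqVneq (dot w w) 0.
    by rewrite (dot_eq0 w0) /f mul0mx /dot !mul0mx mxE mulr0.
  have wp : 0 < dot w w by rewrite lt_def w0 dot_ge0.
  have [t tE] : exists t, t ^+ 2 = dot w w.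
    by exists (Num.sqrt (dot w w)); rewrite sqr_sqrtr ?ltW.
  have t0 : t != 0 by apply: contraNneq w0 => t0; rewrite -tE t0 expr0n.
  have /mem_set/vmax : A (t^-1 *: w).
    by rewrite /A/= dotZl dotZr mulrA -expr2 exprVn tE mulVf.
  rewrite /f -scalemxAl dotZl dotZr mulrA -expr2 exprVn tE.
  by rewrite mulrC ler_pdivrMr.
have fv0 : 0 < f v.
  apply: lt_le_trans (_ : f (delta_mx 0 j) <= _); last first.
    by have := vmax (delta_mx 0 j); rewrite dj mulr1.
  rewrite lt_def dot_ge0 andbT; apply: contraNneq Xij => /dot_eq0 /rowP /(_ i).
  by rewrite -rowE !mxE => ->.
have [g gdef] : exists g, g = v *m X^T *m X - f v *: v by eexists.
have dotX w z : dot (w *m X^T) (z *m X^T) = dot (w *m X^T *m X) z.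
  by rewrite /dot trmx_mul trmxK !mulmxA.
have gE : g = 0.
  apply: dot_eq0.
  have Bg : dot g g = dot (v *m X^T) (g *m X^T) - f v * dot v g.
    by rewrite dotX {1}gdef dotDl -scaleNr dotZl mulNr.
  have hQ : 0 <= f v * dot g g - f g by rewrite subr_ge0.
  set Q := _ - _ in hQ.
  have key t : 0 <= - 2 * t * dot g g + t ^+ 2 * Q.
    have := vmax (v + t *: g).
    rewrite /f mulmxDl -scalemxAl !(dotDl, dotDr, dotZl, dotZr).
    rewrite (dotC (g *m _) (v *m _)) (dotC g v).
    have -> : dot (v *m X^T) (v *m X^T) = f v by [].
    have -> : dot (g *m X^T) (g *m X^T) = f g by [].
    have -> : dot v v = 1 by [].
    by move=> h; rewrite Bg in Q hQ *; rewrite /Q; move: h; rewrite Bg; lra.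
  have := key (dot g g / (Q + 1)).
  have Q1 : Q + 1 != 0 by rewrite gt_eqF// ltr_wpDl.
  have -> : - 2 * (dot g g / (Q + 1)) * dot g g + (dot g g / (Q + 1)) ^+ 2 * Q
     = - ((dot g g / (Q + 1)) ^+ 2 * (Q + 2)) by field.
  rewrite oppr_ge0 => h.
  have : (dot g g / (Q + 1)) ^+ 2 * (Q + 2) == 0.
    by rewrite eq_le h mulr_ge0 ?sqr_ge0// addr_ge0.
  rewrite mulf_eq0 (gt_eqF (_ : 0 < Q + 2)) ?ltr_wpDl// orbF expf_eq0/=.
  by rewrite mulf_eq0 invr_eq0 (negbTE Q1) orbF => /eqP.
pose a := Num.sqrt (f v).
have a0 : 0 < a by rewrite sqrtr_gt0.
have a2 : a ^+ 2 = f v by rewrite sqr_sqrtr// ltW.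
exists (a^-1 *: (v *m X^T)), v, a; split; last first.
  by move=> w; rewrite a2; exact: vmax.
split=> //.
- by rewrite dotZl dotZr mulrA -expr2 exprVn a2 -/(f v) mulVf// gt_eqF.
- by rewrite scalerA mulfV ?scale1r// gt_eqF.
- have /eqP := gE; rewrite gdef subr_eq0 => /eqP e.
  by rewrite -scalemxAl e scalerA -a2 expr2 mulrA mulVf ?mul1r// gt_eqF.
Qed.

Lemma compact_svd_exists p q (X : 'M[R]_(p, q)) :
  exists k (U : 'M[R]_(p, k)) (d : 'rV[R]_k) (V : 'M[R]_(q, k)),
    compact_svd X U d V.
Proof.
have [n] := ubnP (\rank X); elim: n => // n IH in X *; rewrite ltnS => rkX.
have [->|X0] := eqVneq X 0.
  exists 0, 0, 0, 0; split; try by [move=> []|apply/matrixP => -[]].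
  by rewrite !mul0mx.
have [u [v [a [[a0 uu vv vX uX] amax]]]] := top_singular X0.
have uuM : u *m u^T = 1%:M by rewrite [LHS]mx11_scalar -/(dot u u) uu.
have vvM : v *m v^T = 1%:M by rewrite [LHS]mx11_scalar -/(dot v v) vv.
pose X' := X - a *: (u^T *m v).
have uX' : u *m X' = 0.
  by rewrite mulmxBr -scalemxAr mulmxA uuM mul1mx uX subrr.
have vX' : v *m X'^T = 0.
  rewrite linearB/= linearZ/= trmx_mul trmxK mulmxBr -scalemxAr mulmxA vvM.
  by rewrite mul1mx vX subrr.
have vsX : (v <= X)%MS.
  apply/submxP; exists (a^-1 *: u).
  by rewrite -scalemxAl uX scalerA mulVf ?scale1r// gt_eqF.
have : (X' < X)%MS.
  rewrite ltmxE; apply/andP; split.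
    apply: addmx_sub => //; rewrite -scaleNr scalemx_sub//.
    by rewrite (submx_trans _ vsX)// submxMl.
  apply/negP => /(submx_trans vsX)/submxP[z vE].
  have : v *m v^T = 0.
    by rewrite {1}vE -mulmxA -[X' *m _]trmxK trmx_mul trmxK vX' trmx0 mulmx0.
  by rewrite vvM => /matrixP/(_ 0 0)/eqP; rewrite !mxE oner_eq0.
rewrite ltmxErank => /andP[_ rkX'].
have [k [U [d [V [UU VV dle d0 XE]]]]] := IH X' (leq_trans rkX' rkX).
have mul_diag0 (w : 'rV[R]_k) : w *m diag_mx d = 0 -> w = 0.
  move=> /rowP h; apply/rowP => i; have /eqP := h i.
  by rewrite mul_mx_diag !mxE mulf_eq0 (gt_eqF (d0 i)) orbF => /eqP.
have uU : u *m U = 0.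
  apply: mul_diag0; rewrite -[LHS]mulmx1 -VV !mulmxA -(mulmxA u) -(mulmxA u).
  by rewrite -XE uX' mul0mx.
have X'T : X'^T = V *m diag_mx d *m U^T.
  by rewrite XE !trmx_mul trmxK tr_diag_mx mulmxA.
have vV : v *m V = 0.
  apply: mul_diag0; rewrite -[LHS]mulmx1 -UU !mulmxA -(mulmxA v) -(mulmxA v).
  by rewrite -X'T vX' mul0mx.
have da i : d 0 i <= a.
  rewrite -(@ler_pXn2r _ 2) ?nnegrE; [|by []|exact: ltW|exact: ltW].
  pose w := row i V^T.
  have ww : dot w w = 1.
    rewrite /dot /w tr_row trmxK colE mulmxA -row_mul VV row1 mul_delta_mx.
    by rewrite mxE !eqxx.
  have wv : w *m v^T = 0.
    by rewrite -[LHS]trmxK trmx_mul trmxK /w tr_row trmxK colE mulmxA vV mul0mx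
      trmx0.
  have wX : w *m X^T = d 0 i *: row i U^T.
    have -> : X = X' + a *: (u^T *m v) by rewrite /X' subrK.
    rewrite linearD/= linearZ/= trmx_mul trmxK mulmxDr -scalemxAr mulmxA wv.
    rewrite mul0mx scaler0 addr0 X'T /w -row_mul !mulmxA VV mul1mx.
    by rewrite row_mul row_diag_mx -scalemxAl -rowE.
  have := amax w; rewrite ww mulr1 wX dotZl dotZr mulrA -expr2.
  suff -> : dot (row i U^T) (row i U^T) = 1 by rewrite mulr1.
  rewrite /dot tr_row trmxK colE mulmxA -row_mul UU row1 mul_delta_mx.
  by rewrite mxE !eqxx.
exists (1 + k)%N, (row_mx u^T U), (row_mx (const_mx a) d), (row_mx v^T V); split.
- rewrite tr_row_mx mul_col_row trmxK uuM UU uU -[U^T *m _]trmxK trmx_mul !trmxK.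
  by rewrite uU trmx0 -scalar_mx_block.
- rewrite tr_row_mx mul_col_row trmxK vvM VV vV -[V^T *m _]trmxK trmx_mul !trmxK.
  by rewrite vV trmx0 -scalar_mx_block.
- move=> i j; case: (split_ordP i) => i' ->; case: (split_ordP j) => j' ->.
  + by rewrite !row_mxEl !mxE lexx.
  + by rewrite row_mxEl row_mxEr mxE.
  + by rewrite /= (ord1 j') leqNgt addnC addn1.
  + by rewrite !row_mxEr/= leq_add2l; exact: dle.
- move=> i; case: (split_ordP i) => i' ->; first by rewrite row_mxEl mxE.
  by rewrite row_mxEr.
- rewrite diag_mx_row diag_const_mx mul_row_block !mulmx0 addr0 add0r.
  rewrite tr_row_mx mul_row_col trmxK mul_mx_scalar -XE -scalemxAl.
  by rewrite /X' addrC subrK.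
Qed.

End SvdExistence.

Lemma truncation_rule_exists (R : realType) (p q r : nat) :
  exists tr : 'M[R]_(p, q) -> 'M[R]_(p, q), truncation_rule r tr.
Proof.
suff h (X : 'M[R]_(p, q)) : exists Y, svd_truncation r X Y.
  exists (fun X => projT1 (cid (h X))) => X; exact: projT2 (cid (h X)).
have [k [U [d [V h]]]] := compact_svd_exists X.
by eexists; exists k, U, d, V; split.
Qed.

Lemma pinvP (R : realType) (p q : nat) (X : 'M[R]_(p, q)) : penrose X (pinv X).
Proof.
have [k [U [d [V [UU VV _ d0 XE]]]]] := compact_svd_exists X.
pose D := diag_mx d; pose D' := diag_mx (map_mx (@GRing.inv R) d).
have DD' : D *m D' = 1%:M.
  rewrite /D /D' mulmx_diag -diag_const_mx; congr diag_mx.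
  by apply/rowP => i; rewrite !mxE mulfV// gt_eqF.
have D'D : D' *m D = 1%:M by rewrite /D' /D diag_mxC.
pose Y := V *m D' *m U^T.
have XY : X *m Y = U *m U^T.
  rewrite XE /Y -!mulmxA (mulmxA V^T) VV mul1mx (mulmxA (diag_mx d)) -/D DD'.
  by rewrite mul1mx.
have YX : Y *m X = V *m V^T.
  by rewrite XE /Y -!mulmxA (mulmxA U^T) UU mul1mx (mulmxA D') -/D D'D mul1mx.
have : penrose X Y.
  split; rewrite ?XY ?YX ?trmx_mul ?trmxK//.
    by rewrite {1}XE !mulmxA -(mulmxA U) UU mulmx1 -XE.
  by rewrite /Y !mulmxA -(mulmxA V) VV mulmx1.
by move=> h; rewrite /pinv; apply: (xgetI (P := [set Y | penrose X Y]%classic) 0 h).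
Qed.

(* Main.v *)
(* Write B = S^T M P = a D b with a = S^T U, D = diag sigma, b = V^T P,           *)
(* X = S^T (M + E) P, Y = X_r, H = Y - B, Z = X - Y and G the pseudoinverse of Y. *)
(* The (r+1)-st singular value of X is O(E) because rank B = r, so Z and H are    *)
(* O(E).  Since Y has rank at most r and a^+ Y b^+ is close to the invertible D,  *)
(* G stays bounded, and Wedin's formula gives G = B^+ + O(E).  Up to O(E^2), the  *)
(* two terms of Phi with one explicit factor E are then Pi_U E and E Pi_V.  The   *)
(* remaining term M P G S^T M = U a^+ (B G B) b^+ V^T is expanded with B = Y - H  *)
(* and Y G Y = Y; its linear part contains the truncation error only through      *)
(* a^+ Z b^+, which is O(E^2) because Y G Z = 0 and a^+ (1 - Y G) is O(E).        *)

Require Import Defs.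
From HB Require Import structures.
From mathcomp Require Import all_boot all_order all_algebra.
From mathcomp Require Import all_classical all_reals all_analysis.
From mathcomp Require Import ring lra.

Set Implicit Arguments.
Unset Strict Implicit.
Unset Printing Implicit Defensive.

Import Order.TTheory GRing.Theory Num.Theory.
Import numFieldNormedType.Exports.
(* [all_classical] also has a [pinv], for functions. *)
Import Defs.

Local Open Scope ring_scope.

(** At E = 0 the formula reproduces M: there Y = B and B^+ = b^+ D^-1 a^+, so M P B^+ S^T M = M. For
    small E, the terms with one explicit factor E give Pi_U E + E Pi_V. The term M P G S^T M = U a^+
    (B G B) b^+ V^T gives the correction: to first order B G B is B - F with F = S^T E P, and U a^+
    F b^+ V^T = Pi_U E Pi_V.

    Two points need care. Pseudoinversion is discontinuous where the rank jumps; the bound rank Y <=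
    r prevents this ([factor_inner_inverse], [l1_pinv_le]), and [pinvB] then yields [bigO_pinv].
    Truncation may be ambiguous; only two facts about it enter: the discarded part is O(E)
    ([svd_truncation_error]) and is orthogonal to the kept part ([svd_truncation_orth]). By
    [inner_inverse_expansion] it then contributes only at second order.

    [Phi_expansion] collects this for [l1]. Norm equivalence carries it to [N], and
    [oblique_tangent_proj_svd] makes the constants independent of the chosen SVD. *)

(** * The entrywise norm *)

(** This norm is submultiplicative across all rectangular shapes and invariant under transposition,
    so products can be estimated factor by factor. *)
Definition l1 (R : realType) (p q : nat) (A : 'M[R]_(p, q)) : R :=
  \sum_i \sum_j `|A i j|.

Section EntrywiseL1.
Context {R : realType}.

Lemma l1_ge0 p q (A : 'M[R]_(p, q)) : 0 <= l1 A.
Proof. by apply: sumr_ge0 => i _; apply: sumr_ge0. Qed.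

Lemma l1D p q (A B : 'M[R]_(p, q)) : l1 (A + B) <= l1 A + l1 B.
Proof.
rewrite /l1 -big_split ler_sum // => i _; rewrite -big_split ler_sum // => j _.
by rewrite mxE ler_normD.
Qed.

Lemma l1N p q (A : 'M[R]_(p, q)) : l1 (- A) = l1 A.
Proof.
by apply: eq_bigr => i _; apply: eq_bigr => j _; rewrite mxE normrN.
Qed.

Lemma l1Z p q a (A : 'M[R]_(p, q)) : l1 (a *: A) = `|a| * l1 A.
Proof.
rewrite mulr_sumr; apply: eq_bigr => i _; rewrite mulr_sumr.
by apply: eq_bigr => j _; rewrite mxE normrM.
Qed.

Lemma l1_tr p q (A : 'M[R]_(p, q)) : l1 A^T = l1 A.
Proof.
rewrite /l1 exchange_big; apply: eq_bigr => i _.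
by apply: eq_bigr => j _; rewrite mxE.
Qed.

Lemma l1_eq0 p q (A : 'M[R]_(p, q)) : l1 A = 0 -> A = 0.
Proof.
move/eqP; rewrite psumr_eq0 => [/allP h|i _]; last exact: sumr_ge0.
apply/matrixP => i j; rewrite mxE.
have := h i (mem_index_enum i); rewrite /= psumr_eq0// => /allP h'.
by have := h' j (mem_index_enum j); rewrite normr_eq0 => /eqP.
Qed.

Lemma l1_sum (I : Type) (r : seq I) (Q : pred I) p q (F : I -> 'M[R]_(p, q)) :
  l1 (\sum_(i <- r | Q i) F i) <= \sum_(i <- r | Q i) l1 (F i).
Proof.
elim/big_ind2: _ => // [|A a B b Aa Bb].
  by rewrite -(scale0r (0 : 'M[R]_(p, q))) l1Z normr0 mul0r.
exact: le_trans (l1D _ _) (lerD Aa Bb).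
Qed.

Lemma l1M p q s (A : 'M[R]_(p, q)) (B : 'M[R]_(q, s)) :
  l1 (A *m B) <= l1 A * l1 B.
Proof.
pose rB k := \sum_j `|B k j|.
have rB_le k : rB k <= l1 B.
  by rewrite /l1 (bigD1 k)//= lerDl sumr_ge0// => i _; apply: sumr_ge0.
rewrite mulr_suml ler_sum// => i _.
apply: (@le_trans _ _ (\sum_k `|A i k| * rB k)).
  under [leRHS]eq_bigr do rewrite mulr_sumr.
  rewrite exchange_big ler_sum// => j _; rewrite mxE.
  by apply: le_trans (ler_norm_sum _ _ _) _; rewrite ler_sum// => k _; rewrite normrM.
by rewrite mulr_suml ler_sum// => k _; rewrite ler_wpM2l.
Qed.

Lemma l1_bounded p q (A : 'M[R]_(p, q)) :
  (forall i j, `|A i j| <= 1) -> l1 A <= (p * q)%:R.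
Proof.
move=> A1; apply: (@le_trans _ _ (\sum_(i < p) \sum_(j < q) 1)).
  by apply: ler_sum => i _; apply: ler_sum.
by rewrite !sumr_const !card_ord -mulrnA mulnC.
Qed.

Lemma orthonormal_entry_le1 p q (U : 'M[R]_(p, q)) :
  U^T *m U = 1%:M -> forall i j, `|U i j| <= 1.
Proof.
move=> UU i j; have /matrixP/(_ j j) := UU; rewrite !mxE eqxx => UUj.
rewrite -(@ler_pXn2r _ 2)// ?nnegrE// expr1n real_normK ?num_real//.
rewrite -[leRHS]UUj (bigD1 i)//= mxE expr2 lerDl sumr_ge0// => k _.
by rewrite mxE -expr2 sqr_ge0.
Qed.

(** A diagonal entry is the sum of squares of its row, so it dominates its own square and is at most
    1; it also dominates the square of every entry of that row. *)
Lemma orthoproj_entry_le1 p (A : 'M[R]_p) :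
  A^T = A -> A *m A = A -> forall i j, `|A i j| <= 1.
Proof.
move=> AT AA i j; have AC k l : A l k = A k l by rewrite -{1}AT mxE.
have Aii : A i i = A i j ^+ 2 + \sum_(k | k != j) A i k ^+ 2.
  rewrite -{1}AA mxE (bigD1 j)//= AC -expr2; congr (_ + _).
  by apply: eq_bigr => k _; rewrite AC.
have rest_ge0 : 0 <= \sum_(k | k != j) A i k ^+ 2.
  by rewrite sumr_ge0// => k _; exact: sqr_ge0.
have Aii1 : A i i ^+ 2 <= A i i.
  rewrite -[leRHS]/(A i i) -{2}AA mxE (bigD1 i)//= -expr2 lerDl sumr_ge0// => k _.
  by rewrite AC -expr2 sqr_ge0.
rewrite -(@ler_pXn2r _ 2)// ?nnegrE// expr1n real_normK ?num_real//.
by nra.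
Qed.

Lemma orthonormal_cols_le p q (U : 'M[R]_(p, q)) :
  U^T *m U = 1%:M -> (q <= p)%N.
Proof.
move=> UU; rewrite -(mxrank1 R q) -UU.
exact: leq_trans (mxrankM_maxr _ _) (rank_leq_row _).
Qed.

End EntrywiseL1.

(** * Equivalence of [l1] with an arbitrary norm *)

Section NormEquivalence.
Context {R : realType}.

Lemma norm_ge0 (V : lmodType R) (N : V -> R) : is_norm N -> forall x, 0 <= N x.
Proof.
move=> [_ NZ ND] x; have := ND x (- x).
rewrite subrr -scaleN1r NZ normrN normr1 mul1r -(scale0r x) NZ normr0 mul0r.
by rewrite -mulr2n pmulrn_lge0.
Qed.

Lemma norm_le_l1 p q (N : 'M[R]_(p, q) -> R) : is_norm N ->
  exists2 K, 0 < K & forall A, N A <= K * l1 A.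
Proof.
move=> hN; have N0 := norm_ge0 hN; case: hN => _ NZ ND.
have NS (I : Type) (r : seq I) (F : I -> 'M[R]_(p, q)) :
    N (\sum_(i <- r) F i) <= \sum_(i <- r) N (F i).
  elim/big_ind2: _ => // [|A a B b Aa Bb].
    by rewrite -(scale0r (0 : 'M[R]_(p, q))) NZ normr0 mul0r.
  exact: le_trans (ND _ _) (lerD Aa Bb).
pose K := 1 + \sum_i \sum_j N (delta_mx i j).
have K_ge i j : N (delta_mx i j) <= K.
  apply: (@le_trans _ _ (\sum_j N (delta_mx i j))).
    by rewrite (bigD1 j)//= lerDl sumr_ge0.
  rewrite /K (bigD1 i)//= addrCA lerDl addr_ge0// sumr_ge0// => k _.
  exact: sumr_ge0.
exists K => [|A]; first by rewrite ltr_wpDr// sumr_ge0// => i _; rewrite sumr_ge0.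
rewrite {1}(matrix_sum_delta A) mulr_sumr; apply: le_trans (NS _ _ _) _.
rewrite ler_sum// => i _; rewrite mulr_sumr; apply: le_trans (NS _ _ _) _.
by rewrite ler_sum// => j _; rewrite NZ mulrC ler_wpM2r.
Qed.

(* On the compact unit sphere of the max norm, [N] attains a positive minimum. *)
Lemma l1_le_norm_row q (N : 'rV[R]_q -> R) : is_norm N ->
  exists2 K, 0 < K & forall v, l1 v <= K * N v.
Proof.
move=> hN; have N0 := norm_ge0 hN; have [K K0 NK] := norm_le_l1 hN.
case: hN => Neq0 NZ ND.
have normE (v : 'rV[R]_q) : l1 v <= q%:R * `|v|.
  rewrite /l1 big_ord1 -[X in X%:R]card_ord -sumr_const mulr_suml ler_sum// => j _.
  by rewrite mul1r [leRHS]/Num.norm/= mx_normrE; exact: (le_bigmax _ _ (0, j)).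
(* The [+ 1] keeps the Lipschitz constant positive even for [q = 0], since the continuity proof
   divides by it. *)
have Nlip v w : `|N v - N w| <= (K * q%:R + 1) * `|v - w|.
  apply: (@le_trans _ _ (N (v - w))); last first.
    apply: le_trans (NK _) _; rewrite mulrDl mul1r ler_wpDr// -mulrA.
    by rewrite ler_wpM2l// ltW.
  have := ND (v - w) w; have := ND (w - v) v; rewrite !subrK.
  have -> : N (w - v) = N (v - w).
    by rewrite -opprB -scaleN1r NZ normrN normr1 mul1r.
  by rewrite ler_norml; lra.
have Ncont : continuous N.
  move=> v; have nbhsF := nbhs_filter v.
  apply/(@cvgrPdist_le _ _ _ (nbhs v) nbhsF) => /= e e0.
  have Kq : 0 < K * q%:R + 1 by rewrite ltr_wpDl// mulr_ge0// ltW.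
  have := @cvgr_dist_le _ _ _ (nbhs v) _ id v (@cvg_id _ (nbhs v)) _ (divr_gt0 e0 Kq).
  move=> /(_ nbhsF); apply: (@filterS _ (nbhs v) nbhsF) => w vw.
  by apply: le_trans (Nlip v w) _; rewrite -ler_pdivlMl// mulrC.
pose A : set 'rV[R]_q := [set w | `|w| = 1]%classic.
have [q0|q0] := posnP q.
  exists 1 => // v; rewrite mul1r; subst q.
  by rewrite /l1 big_ord1 big_ord0.
have A0 : (A !=set0)%classic.
  have d0 : `|const_mx 1 : 'rV[R]_q| != 0.
    by rewrite normr_eq0; apply/eqP => /rowP/(_ (Ordinal q0))/eqP; rewrite !mxE oner_eq0.
  exists (`|const_mx 1 : 'rV[R]_q|^-1 *: const_mx 1).
  by rewrite /A/= normrZ ger0_norm ?invr_ge0// mulVf.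
have cA : compact A.
  apply: bounded_closed_compact.
    exists 1; split; first exact: num_real.
    by move=> y y1 w /= ->; exact: ltW.
  have -> : A = ((fun w => `|w|) @^-1` [set 1])%classic by [].
  apply: preimage_closed; last exact: closed_eq.
  by move=> w _; exact: norm_continuous.
have [u /set_mem/= Au umin] := compact_EVT_min A0 cA (continuous_subspaceT Ncont).
have Nu : 0 < N u.
  rewrite lt_def N0 andbT; apply/eqP => /Neq0 u0.
  by move: Au; rewrite /A/= u0 normr0 => /eqP; rewrite eq_sym oner_eq0.
exists (q%:R * (N u)^-1) => [|v]; first by rewrite mulr_gt0 ?invr_gt0// ltr0n.
apply: le_trans (normE v) _; rewrite -mulrA ler_wpM2l// ler_pdivlMl//.
have [->|v0] := eqVneq v 0; first by rewrite normr0 mulr0 N0.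
have nv : 0 < `|v| by rewrite normr_gt0.
have /mem_set/umin : A (`|v|^-1 *: v).
  by rewrite /A/= normrZ ger0_norm ?invr_ge0// mulVf// gt_eqF.
by rewrite NZ ger0_norm ?invr_ge0// ler_pdivlMl// mulrC.
Qed.

Lemma l1_le_norm p q (N : 'M[R]_(p, q) -> R) : is_norm N ->
  exists2 K, 0 < K & forall A, l1 A <= K * N A.
Proof.
move=> [Neq0 NZ ND].
have hN : is_norm (fun v : 'rV[R]_(p * q) => N (vec_mx v)).
  split=> [v /Neq0 v0|a v|v w]; last by rewrite linearD.
    by apply: (can_inj vec_mxK); rewrite v0 linear0.
  by rewrite linearZ NZ.
have [K K0 NK] := l1_le_norm_row hN; exists K => // A.
have := NK (mxvec A); rewrite mxvecK; apply: le_trans.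
rewrite /l1 big_ord1 pair_bigA/= (reindex _ (curry_mxvec_bij p q))/=.
by apply: ler_sum => -[i j] _ /=; rewrite mxvecE.
Qed.

End NormEquivalence.

(* Only the values at parameters [t] with [e t] small matter, and the constants *)
(* are uniform in [t].                                                          *)
Definition bigO (R : realType) (T : Type) (e : T -> R) (k p q : nat)
    (f : T -> 'M[R]_(p, q)) : Prop :=
  exists C delta : R, [/\ 0 <= C, 0 < delta &
    forall t, e t < delta -> l1 (f t) <= C * e t ^+ k].

(** * Calculus of uniform O-estimates *)

Section BigO.
Context {R : realType} {T : Type} {e : T -> R}.
Hypothesis e_ge0 : forall t, 0 <= e t.

Lemma bigO_cst p q (A : 'M[R]_(p, q)) : bigO e 0 (fun _ => A).
Proof.
exists (l1 A), 1; split=> // [|t _]; first exact: l1_ge0.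
by rewrite expr0 mulr1.
Qed.

Lemma bigO_id p q (f : T -> 'M[R]_(p, q)) : (forall t, l1 (f t) <= e t) -> bigO e 1 f.
Proof. by move=> fe; exists 1, 1; split=> // t _; rewrite mul1r expr1. Qed.

Lemma bigOD k p q (f g : T -> 'M[R]_(p, q)) :
  bigO e k f -> bigO e k g -> bigO e k (fun t => f t + g t).
Proof.
move=> [C [a [C0 a0 fC]]] [D [b [D0 b0 gD]]].
exists (C + D), (Num.min a b); split; first exact: addr_ge0.
  by rewrite lt_min a0.
move=> t; rewrite lt_min => /andP[ta tb]; apply: le_trans (l1D _ _) _.
by rewrite mulrDl lerD ?fC ?gD.
Qed.

Lemma bigON k p q (f : T -> 'M[R]_(p, q)) :
  bigO e k f -> bigO e k (fun t => - f t).
Proof.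
move=> [C [a [C0 a0 fC]]]; exists C, a; split=> // t ta.
by rewrite l1N fC.
Qed.

Lemma bigOB k p q (f g : T -> 'M[R]_(p, q)) :
  bigO e k f -> bigO e k g -> bigO e k (fun t => f t - g t).
Proof. by move=> hf hg; apply: bigOD => //; exact: bigON. Qed.

Lemma bigOM k l p q s (f : T -> 'M[R]_(p, q)) (g : T -> 'M[R]_(q, s)) :
  bigO e k f -> bigO e l g -> bigO e (k + l) (fun t => f t *m g t).
Proof.
move=> [C [a [C0 a0 fC]]] [D [b [D0 b0 gD]]].
exists (C * D), (Num.min a b); split; first exact: mulr_ge0.
  by rewrite lt_min a0.
move=> t; rewrite lt_min => /andP[ta tb]; apply: le_trans (l1M _ _) _.
by rewrite exprD mulrACA ler_pM ?l1_ge0 ?fC ?gD.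
Qed.

Lemma bigO_tr k p q (f : T -> 'M[R]_(p, q)) :
  bigO e k f -> bigO e k (fun t => (f t)^T).
Proof.
move=> [C [a [C0 a0 fC]]]; exists C, a; split=> // t ta.
by rewrite l1_tr fC.
Qed.

Lemma bigO_weaken k l p q (f : T -> 'M[R]_(p, q)) : (l <= k)%N ->
  bigO e k f -> bigO e l f.
Proof.
move=> lk [C [a [C0 a0 fC]]]; exists C, (Num.min a 1); split=> //.
  by rewrite lt_min a0 ltr01.
move=> t; rewrite lt_min => /andP[ta t1]; apply: le_trans (fC t ta) _.
by rewrite ler_wpM2l// ler_wiXn2l// ltW.
Qed.

Lemma bigO_le_near k p q p' q' (f : T -> 'M[R]_(p, q)) (g : T -> 'M[R]_(p', q')) :
  (exists K delta : R, [/\ 0 <= K, 0 < delta &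
    forall t, e t < delta -> l1 (g t) <= K * l1 (f t)]) ->
  bigO e k f -> bigO e k g.
Proof.
move=> [K [b [K0 b0 gK]]] [C [a [C0 a0 fC]]].
exists (K * C), (Num.min a b); split; first exact: mulr_ge0.
  by rewrite lt_min a0.
move=> t; rewrite lt_min => /andP[ta tb]; apply: le_trans (gK t tb) _.
by rewrite -mulrA ler_wpM2l// fC.
Qed.

Lemma bigO_eq k p q (f g : T -> 'M[R]_(p, q)) :
  (forall t, g t = f t) -> bigO e k f -> bigO e k g.
Proof.
move=> gf; apply: bigO_le_near; exists 1, 1; split=> // t _.
by rewrite gf mul1r.
Qed.

Lemma bigO1_small p q (f : T -> 'M[R]_(p, q)) (eps : R) : 0 < eps ->
  bigO e 1 f -> exists delta, 0 < delta /\ forall t, e t < delta -> l1 (f t) <= eps.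
Proof.
move=> eps0 [C [a [C0 a0 fC]]].
have C1 : 0 < C + 1 by rewrite ltr_wpDl.
exists (Num.min a (eps / (C + 1))); split; first by rewrite lt_min a0 divr_gt0.
move=> t; rewrite lt_min => /andP[ta]; rewrite ltr_pdivlMr// => te.
apply: le_trans (fC t ta) _; rewrite expr1; apply: le_trans (ltW te).
by rewrite mulrC ler_wpM2l// lerDl.
Qed.

(* Neumann's argument: near [A] the matrix [1 - A^-1 K] has norm at most 1/2. *)
Lemma bigO_invmx p (A : 'M[R]_p) (K : T -> 'M[R]_p) : A \in unitmx ->
  bigO e 1 (fun t => K t - A) ->
  exists delta, 0 < delta /\ forall t, e t < delta ->
    K t \in unitmx /\ l1 (invmx (K t)) <= 2 * l1 (invmx A).
Proof.
move=> uA KA.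
have /(bigO1_small (eps := 1/2)) : bigO e 1 (fun t => invmx A *m (A - K t)).
  apply: (bigOM (bigO_cst _)).
  by apply: bigO_eq (bigON KA) => t; rewrite opprB.
case=> [|delta [d0 small]]; first by lra.
exists delta; split=> // t /small {}small.
have AK : invmx A *m (A - K t) = 1%:M - invmx A *m K t.
  by rewrite mulmxBr mulVmx.
(* Half of [l1 z] is absorbed on the left. Applied to the kernel of [K t] this forces z = 0; applied
   to the inverse of [K t] it gives the bound. *)
have half q (z : 'M[R]_(p, q)) : l1 z <= 2 * l1 (invmx A *m (K t *m z)).
  have zE : z = invmx A *m (A - K t) *m z + invmx A *m (K t *m z).
    by rewrite AK mulmxBl mul1mx -!mulmxA subrK.
  have : l1 z <= l1 (invmx A *m (A - K t) *m z) + l1 (invmx A *m (K t *m z)).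
    by rewrite {1}zE l1D.
  have : l1 (invmx A *m (A - K t) *m z) <= 1/2 * l1 z.
    by apply: le_trans (l1M _ _) _; rewrite ler_wpM2r// l1_ge0.
  by lra.
have uK : K t \in unitmx.
  rewrite -unitmx_tr -row_free_unit -kermx_eq0; apply/eqP/trmx_inj.
  rewrite trmx0; apply: l1_eq0; apply/eqP; rewrite eq_le l1_ge0 andbT.
  apply: le_trans (half _ _) _.
  have -> : K t *m (kermx (K t)^T)^T = 0.
    by apply: trmx_inj; rewrite trmx_mul trmxK mulmx_ker trmx0.
  rewrite mulmx0.
  by rewrite -(scale0r (0 : 'M[R]_p)) l1Z normr0 mul0r mulr0.
split=> //; apply: le_trans (half _ _) _.
by rewrite mulmxV// mulmx1.
Qed.

End BigO.

(** * Bounds and identities for pseudoinverses *)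

Section Pseudoinverse.
Context {R : realType}.

Lemma penrose_pinv p q (X : 'M[R]_(p, q)) Y : penrose X Y -> pinv X = Y.
Proof. exact: penrose_uniq (pinvP X). Qed.

Lemma pinv_tr p q (X : 'M[R]_(p, q)) : pinv X^T = (pinv X)^T.
Proof.
apply: penrose_pinv; have [XYX YXY XYT YXT] := pinvP X.
by split; rewrite -!trmx_mul ?trmxK ?YXT ?XYT// mulmxA ?XYX ?YXY.
Qed.

Lemma pinv_mulmx_full p q (X : 'M[R]_(p, q)) : \rank X = q -> pinv X *m X = 1%:M.
Proof.
move=> rX; have /row_fullP[Z ZX] : row_full X by rewrite /row_full rX.
have [XYX _ _ _] := pinvP X.
by rewrite -[LHS]mul1mx -{1}ZX -!mulmxA (mulmxA X) XYX ZX.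
Qed.

Lemma mulmx_pinv_full p q (X : 'M[R]_(p, q)) : \rank X = p -> X *m pinv X = 1%:M.
Proof.
move=> rX; apply: trmx_inj; rewrite trmx_mul -pinv_tr trmx1; apply: pinv_mulmx_full.
by rewrite mxrank_tr.
Qed.

Lemma pinv_proj_entry_le1 p q (X : 'M[R]_(p, q)) :
  (forall i j, `|(pinv X *m X) i j| <= 1) /\ (forall i j, `|(X *m pinv X) i j| <= 1).
Proof.
have [XYX YXY XYT YXT] := pinvP X.
by split; apply: orthoproj_entry_le1 => //; rewrite mulmxA ?XYX ?YXY.
Qed.

(** X^+ = (X^+ X) Z (X X^+) for every inner inverse Z, and the outer factors are orthogonal
    projectors, with entries at most 1. *)
Lemma l1_pinv_le p q (X : 'M[R]_(p, q)) Z : X *m Z *m X = X ->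
  l1 (pinv X) <= (q * q)%:R * (p * p)%:R * l1 Z.
Proof.
move=> XZX; have [XYX YXY XYT YXT] := pinvP X.
have [le1 le2] := pinv_proj_entry_le1 X.
have -> : pinv X = pinv X *m X *m Z *m (X *m pinv X).
  by rewrite !mulmxA -(mulmxA _ X Z) -(mulmxA _ _ X) XZX YXY.
apply: le_trans (l1M _ _) _; rewrite mulrAC ler_pM ?l1_ge0 ?l1_bounded//.
by apply: le_trans (l1M _ _) _; rewrite ler_wpM2r ?l1_ge0 ?l1_bounded.
Qed.

(* Wedin's decomposition of the difference of two pseudoinverses. *)
Lemma pinvB p q (Y B : 'M[R]_(p, q)) (G := pinv Y) (L := pinv B) (H := Y - B) :
  G - L = G *m G^T *m H^T *m (1%:M - B *m L) + (1%:M - G *m Y) *m H^T *m L^T *m L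
          - G *m H *m L.
Proof.
have [YGY GYG YGT GYT] := pinvP Y; have [BLB LBL BLT LBT] := pinvP B.
rewrite -/G -/L in YGY GYG YGT GYT BLB LBL BLT LBT *.
have HT : H^T = Y^T - B^T by rewrite /H linearB.
have e1 : G *m G^T *m H^T *m (1%:M - B *m L) = G - G *m B *m L.
  have hY : G *m G^T *m Y^T = G by rewrite -mulmxA -trmx_mul YGT mulmxA.
  have hB : B^T *m (1%:M - B *m L) = 0.
    by rewrite mulmxBr mulmx1 -BLT -trmx_mul BLB subrr.
  rewrite HT (mulmxBr (G *m _)) hY mulmxBl -(mulmxA _ B^T) hB mulmx0 subr0.
  by rewrite mulmxBr mulmx1 mulmxA.
have e2 : (1%:M - G *m Y) *m H^T *m L^T *m L = - (L - G *m Y *m L).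
  have hL : B^T *m L^T *m L = L by rewrite -trmx_mul LBT.
  have hY : (1%:M - G *m Y) *m Y^T = 0.
    by rewrite mulmxBl mul1mx -GYT -trmx_mul mulmxA YGY subrr.
  rewrite HT (mulmxBr (1%:M - _)) hY sub0r !mulNmx -!(mulmxA _ B^T) -!mulmxA.
  by rewrite (mulmxA B^T) hL mulmxBl mul1mx !mulmxA.
rewrite e1 e2 /H mulmxBr mulmxBl.
by rewrite !opprB addrACA; apply/matrixP => i j; rewrite !mxE; ring.
Qed.

End Pseudoinverse.

(** * Truncated singular value decompositions *)

Section Truncation.
Context {R : realType}.

(** The square matrix A Y B = (A L)(Q B) is invertible, so Q B W is a right, hence two-sided,
    inverse of A L; placing their product between L and Q gives the identity. *)
Lemma factor_inner_inverse p q r (Y : 'M[R]_(p, q)) (L : 'M[R]_(p, r)) (Q : 'M[R]_(r, q))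
    (A : 'M[R]_(r, p)) (B : 'M[R]_(q, r)) :
  Y = L *m Q -> A *m Y *m B \in unitmx ->
  Y *m (B *m invmx (A *m Y *m B) *m A) *m Y = Y.
Proof.
move=> YE uK; pose W := invmx (A *m Y *m B).
have KW : (A *m L) *m (Q *m B *m W) = 1%:M.
  by rewrite -(mulmxV uK) -/W YE !mulmxA.
have WL := mulmx1C KW; rewrite -/W.
rewrite {1 2}YE; transitivity (L *m (Q *m B *m W *m (A *m L)) *m Q).
  by rewrite !mulmxA.
by rewrite WL mulmx1 YE.
Qed.

Lemma diag_sum_cols p q k (U : 'M[R]_(p, k)) (d : 'rV[R]_k) (V : 'M[R]_(q, k)) :
  U *m diag_mx d *m V^T = \sum_i d 0 i *: (col i U *m (col i V)^T).
Proof.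
apply/matrixP => a b; rewrite mxE summxE; apply: eq_bigr => i _.
by rewrite mul_mx_diag !mxE big_ord1 !mxE mulrAC mulrC.
Qed.

Lemma svd_truncation_split p q r (X Y : 'M[R]_(p, q)) : svd_truncation r X Y ->
  exists k (U : 'M[R]_(p, k)) (d : 'rV[R]_k) (V : 'M[R]_(q, k)),
  [/\ compact_svd X U d V,
      Y = U *m diag_mx (\row_i (if (i < r)%N then d 0 i else 0)) *m V^T &
      X - Y = U *m diag_mx (\row_i (if (i < r)%N then 0 else d 0 i)) *m V^T].
Proof.
move=> [k [U [d [V [svdX YE]]]]]; exists k, U, d, V.
have YE' : Y = U *m diag_mx (\row_i (if (i < r)%N then d 0 i else 0)) *m V^T.
  rewrite YE diag_sum_cols big_mkcond/=; apply: eq_bigr => i _.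
  by rewrite mxE; case: ifP; rewrite ?scale0r.
split=> //; have [_ _ _ _ XE] := svdX.
rewrite YE' {1}XE -mulmxBl -mulmxBr -linearB/=; congr (_ *m diag_mx _ *m _).
by apply/rowP => i; rewrite !mxE; case: ifP; rewrite ?subrr ?subr0.
Qed.

Lemma svd_truncation_factor p q r (X Y : 'M[R]_(p, q)) : svd_truncation r X Y ->
  exists (L : 'M[R]_(p, r)) (Q : 'M[R]_(r, q)), Y = L *m Q.
Proof.
move=> /svd_truncation_split[k [U [d [V [_ -> _]]]]].
set D := diag_mx _.
(* The two partial identities multiply to the projector onto the first r coordinates, also when k <
   r. *)
have DE : D = D *m (pid_mx r : 'M[R]_(k, r)) *m (pid_mx r : 'M[R]_(r, k)).
  rewrite -mulmxA mul_pid_mx !minnn /D mul_diag_mx; apply/matrixP => i j.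
  rewrite !mxE -(inj_eq val_inj i j)/=; case: eqP => [/val_inj ->|_] /=.
    by case: ifP; rewrite ?mulr1 ?mulr0.
  by rewrite mulr0.
exists (U *m D *m (pid_mx r : 'M[R]_(k, r))), ((pid_mx r : 'M[R]_(r, k)) *m V^T).
by rewrite {1}DE !mulmxA.
Qed.

Lemma svd_truncation_orth p q r (X Y : 'M[R]_(p, q)) : svd_truncation r X Y ->
  Y^T *m (X - Y) = 0.
Proof.
move=> /svd_truncation_split[k [U [d [V [[UU _ _ _ _] YE ->]]]]].
rewrite {1}YE !trmx_mul trmxK tr_diag_mx !mulmxA -(mulmxA _ U^T) UU mulmx1.
rewrite -(mulmxA V) mulmx_diag; set D := diag_mx _.
suff -> : D = 0 by rewrite mulmx0 mul0mx.
apply/matrixP => i j; rewrite !mxE.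
by case: ifP; rewrite ?mulr0 ?mul0r mul0rn.
Qed.

(* [B] annihilates some combination [z] of [r+1] leading singular directions of *)
(* [X], on which [X] is bounded below by its [r+1]-st singular value.           *)
Lemma singular_value_le p q k r (X B : 'M[R]_(p, q)) (U : 'M[R]_(p, k))
    (d : 'rV[R]_k) (V : 'M[R]_(q, k)) (i : 'I_k) :
  compact_svd X U d V -> (\rank B <= r)%N -> (r <= i)%N ->
  d 0 i <= (p * r.+1)%:R * (q * r.+1)%:R * l1 (X - B).
Proof.
move=> [UU VV dle d0 XE] rB ri.
have rk : (r < k)%N := leq_ltn_trans ri (ltn_ord i).
pose w := widen_ord rk.
pose A := (colsub w U)^T; pose C := colsub w V.
have [z z0 zB] : exists2 z : 'rV[R]_r.+1, z != 0 & z *m (A *m B *m C) = 0.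
  have : kermx (A *m B *m C) != 0.
    (* The compressed matrix has size r+1 but rank at most r. *)
    rewrite kermx_eq0 /row_free neq_ltn ltnS.
    apply/orP; left; apply: leq_trans rB.
    exact: leq_trans (mxrankM_maxl _ _) (mxrankM_maxr _ _).
  case/rowV0Pn => z /sub_kermxP zB z0; by exists z.
have AX : A *m X *m C = diag_mx (\row_j d 0 (w j)).
  have -> : A = rowsub w 1%:M *m U^T by rewrite -rowsubE /A trmx_mxsub.
  have -> : C = V *m colsub w 1%:M by rewrite mulmx_colsub mulmx1.
  rewrite XE !mulmxA -(mulmxA _ U^T) UU mulmx1 -(mulmxA _ V^T) VV mulmx1.
  rewrite mul_rowsub_mx mul1mx mulmx_colsub mulmx1.
  by apply/matrixP => a b; rewrite !mxE.
have zX : z *m diag_mx (\row_j d 0 (w j)) = z *m (A *m (X - B) *m C).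
  by rewrite mulmxBr mulmxBl AX mulmxBr zB subr0.
have z_gt0 : 0 < l1 z.
  by rewrite lt_def l1_ge0 andbT; apply: contraNneq z0 => /l1_eq0 ->.
rewrite -(ler_pM2l z_gt0).
apply: (@le_trans _ _ (l1 (z *m (A *m (X - B) *m C)))).
  rewrite -zX mul_mx_diag /l1 !big_ord1 mulr_suml ler_sum// => j _.
  rewrite !mxE normrM ler_wpM2l// gtr0_norm//.
  by apply: dle; rewrite /= (leq_trans _ ri)// -ltnS.
apply: le_trans (l1M _ _) _; rewrite ler_wpM2l ?l1_ge0//.
have le1 (p' : nat) (W : 'M[R]_(p', k)) : W^T *m W = 1%:M ->
    l1 (colsub w W) <= (p' * r.+1)%:R.
  move=> WW; apply: l1_bounded => a b; rewrite mxE; exact: orthonormal_entry_le1.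
apply: le_trans (l1M _ _) _; rewrite mulrAC ler_pM ?l1_ge0 ?le1//.
by apply: le_trans (l1M _ _) _; rewrite ler_wpM2r ?l1_ge0// /A l1_tr le1.
Qed.

(** The error is a sum of k <= p rank-one terms. The vectors have entries at most 1, and each
    surviving singular value is bounded by [singular_value_le]. *)
Lemma svd_truncation_error p q r (X Y B : 'M[R]_(p, q)) :
  svd_truncation r X Y -> (\rank B <= r)%N ->
  l1 (X - Y) <= (p * (p * q))%:R * ((p * r.+1)%:R * (q * r.+1)%:R) * l1 (X - B).
Proof.
move=> /svd_truncation_split[k [U [d [V [svdX _ ->]]]]] rB.
have [UU VV _ d0 _] := svdX.
have kp := orthonormal_cols_le UU.
rewrite diag_sum_cols -(mulrA _%:R); set K := _ * l1 _.
have K0 : 0 <= K by rewrite !mulr_ge0 ?l1_ge0.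
apply: le_trans (l1_sum _ _ _) _.
apply: (@le_trans _ _ (\sum_(i < k) (p * q)%:R * K)); last first.
  rewrite sumr_const card_ord -(mulr_natl _ k) (mulrA k%:R) -natrM ler_wpM2r//.
  by rewrite ler_nat leq_mul2r kp orbT.
apply: ler_sum => i _; rewrite l1Z mxE mulrC.
have colE (p' : nat) (W : 'M[R]_(p', k)) : W^T *m W = 1%:M -> l1 (col i W) <= p'%:R.
  move=> WW; rewrite -[p' in leRHS]muln1; apply: l1_bounded => a b.
  by rewrite mxE; exact: orthonormal_entry_le1.
apply: ler_pM => //; first exact: l1_ge0.
  rewrite natrM; apply: le_trans (l1M _ _) _.
  by rewrite l1_tr ler_pM ?l1_ge0 ?colE.
case: ltnP => ri; first by rewrite normr0.
by rewrite gtr0_norm//; exact: singular_value_le svdX rB ri.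
Qed.

End Truncation.

(** * Perturbation of the pseudoinverse and expansion of [Phi] *)

Section Perturbation.
Context {R : realType}.

(** Since K = a^+ Y b^+ is close to D, it is invertible with bounded inverse; the factorization of Y
    through dimension r makes b^+ K^-1 a^+ an inner inverse of Y, which bounds Y^+. Every term of
    [pinvB] then carries one factor H = O(e). *)
Lemma bigO_pinv (T : Type) (e : T -> R) p q r (a : 'M[R]_(p, r)) (D : 'M[R]_r)
    (b : 'M[R]_(r, q)) (Y : T -> 'M[R]_(p, q)) :
  (forall t, 0 <= e t) -> \rank a = r -> \rank b = r -> D \in unitmx ->
  (forall t, exists (L : 'M[R]_(p, r)) (Q : 'M[R]_(r, q)), Y t = L *m Q) ->
  bigO e 1 (fun t => Y t - a *m D *m b) ->
  bigO e 0 (fun t => pinv (Y t)) /\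
  bigO e 1 (fun t => pinv (Y t) - pinv (a *m D *m b)).
Proof.
move=> e0 ra rb uD YLQ OH.
have pa1 := pinv_mulmx_full ra.
have pb1 := mulmx_pinv_full rb.
have OK : bigO e 1 (fun t => pinv a *m Y t *m pinv b - D).
  apply: bigO_eq (bigOM (bigOM (bigO_cst (pinv a)) OH) (bigO_cst (pinv b))) => t.
  by rewrite mulmxBr mulmxBl !mulmxA pa1 mul1mx -(mulmxA D) pb1 mulmx1.
have OG : bigO e 0 (fun t => pinv (Y t)).
  have [delta [d0 KD]] := bigO_invmx e0 uD OK.
  exists ((q * q)%:R * (p * p)%:R * (l1 (pinv b) * (2 * l1 (invmx D)) * l1 (pinv a))).
  exists delta; split=> // [|t /KD[uK leK]].
    by rewrite !mulr_ge0 ?l1_ge0.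
  have [L [Q YE]] := YLQ t.
  rewrite expr0 mulr1; apply: le_trans (l1_pinv_le (factor_inner_inverse YE uK)) _.
  rewrite ler_wpM2l//; apply: le_trans (l1M _ _) _; rewrite ler_wpM2r ?l1_ge0//.
  by apply: le_trans (l1M _ _) _; rewrite ler_wpM2l ?l1_ge0.
split=> //; set B := a *m D *m b in OH *.
apply: bigO_eq (fun t => pinvB (Y t) B) _.
have OY : bigO e 0 Y.
  apply: bigO_eq (bigOD (bigO_weaken e0 (leq0n 1) OH) (bigO_cst B)) => t.
  by rewrite subrK.
have OHT := bigO_tr OH.
apply: bigOB; first apply: bigOD.
- exact (bigOM (bigOM (bigOM OG (bigO_tr OG)) OHT) (bigO_cst _)).
- have O1 : bigO e 0 (fun t => 1%:M - pinv (Y t) *m Y t).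
    exact (bigOB (bigO_cst _) (bigOM OG OY)).
  exact (bigOM (bigOM (bigOM O1 OHT) (bigO_cst _)) (bigO_cst _)).
- exact (bigOM (bigOM OG OH) (bigO_cst _)).
Qed.

Lemma pinv_mul_full p q r (a : 'M[R]_(p, r)) (D : 'M[R]_r) (b : 'M[R]_(r, q)) :
  \rank a = r -> \rank b = r -> D \in unitmx ->
  pinv (a *m D *m b) = pinv b *m invmx D *m pinv a.
Proof.
move=> ra rb uD; have pa1 := pinv_mulmx_full ra.
have pb1 := mulmx_pinv_full rb.
have [_ paE apT _] := pinvP a; have [_ pbE _ pbT] := pinvP b.
have e1 : a *m D *m b *m (pinv b *m invmx D *m pinv a) = a *m pinv a.
  by rewrite !mulmxA -(mulmxA _ b) pb1 mulmx1 -(mulmxA a) mulmxV// mulmx1.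
have e2 : pinv b *m invmx D *m pinv a *m (a *m D *m b) = pinv b *m b.
  by rewrite !mulmxA -(mulmxA _ _ a) pa1 mulmx1 -(mulmxA (pinv b)) mulVmx// mulmx1.
apply: penrose_pinv; split; rewrite ?e1 ?e2 ?apT ?pbT//.
  by rewrite !mulmxA -(mulmxA a) pa1 mulmx1.
by rewrite !mulmxA pbE.
Qed.

(** With B = Y - H and F = H + Z the left side is B G B - B + F. On the right H or Z meets a
    complementary projector, or H occurs twice; multiplied by a^+ and b^+, every term becomes second
    order. *)
Lemma inner_inverse_expansion p q (Y H Z : 'M[R]_(p, q)) (G : 'M[R]_(q, p)) :
  Y *m G *m Y = Y -> Y *m G *m Z = 0 ->
  (Y - H) *m G *m (Y - H) - (Y - H) + (H + Z) =
  (1%:M - Y *m G) *m H + H *m (1%:M - G *m Y) + (1%:M - Y *m G) *m Z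
  + H *m G *m H.
Proof.
move=> YGY YGZ; rewrite !(mulmxBl, mulmxBr) YGY YGZ !mul1mx mulmx1 !mulmxA.
by apply/matrixP => i j; rewrite !mxE; ring.
Qed.

Lemma Phi_expansion (T : Type) m n s c r (M : 'M[R]_(m, n)) (U : 'M[R]_(m, r))
    (d : 'rV[R]_r) (V : 'M[R]_(n, r)) (S : 'M[R]_(m, s)) (P : 'M[R]_(n, c))
    (E : T -> 'M[R]_(m, n)) (tr : T -> 'M[R]_(s, c) -> 'M[R]_(s, c)) :
  compact_svd M U d V -> \rank (S^T *m U) = r -> \rank (V^T *m P) = r ->
  (forall t, truncation_rule r (tr t)) ->
  bigO (fun t => l1 (E t)) 2
    (fun t => Phi (tr t) S P (M + E t) - M - oblique_tangent_proj S P U V (E t)).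
Proof.
move=> [UU VV _ d0 ME] ra rb trP.
have uD : diag_mx d \in unitmx.
  rewrite unitmxE det_diag unitfE; apply/prodf_neq0 => i _.
  by rewrite gt_eqF.
have [a aE] : exists a, a = S^T *m U by eexists.
have [b bE] : exists b, b = V^T *m P by eexists.
have [D DE] : exists D, D = diag_mx d by eexists.
rewrite -aE in ra; rewrite -bE in rb; rewrite -DE in ME uD.
pose B := a *m D *m b; pose L := pinv B.
pose X t := S^T *m (M + E t) *m P; pose Y t := tr t (X t); pose G t := pinv (Y t).
pose F t := S^T *m E t *m P; pose H t := Y t - B; pose Z t := X t - Y t.
have e0 t : 0 <= l1 (E t) by exact: l1_ge0.
have pa1 := pinv_mulmx_full ra.
have pb1 := mulmx_pinv_full rb.
have LE : L = pinv b *m invmx D *m pinv a by exact: pinv_mul_full.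
have BE : B = S^T *m M *m P by rewrite ME /B aE bE !mulmxA.
have XF t : X t - B = F t by rewrite /X BE mulmxDr mulmxDl addrAC subrr add0r.
have OE : bigO (fun t => l1 (E t)) 1 E by exact: bigO_id.
have OF : bigO (fun t => l1 (E t)) 1 F.
  exact (bigOM (bigOM (bigO_cst _) OE) (bigO_cst _)).
have rB : (\rank B <= r)%N.
  by apply: leq_trans (mxrankM_maxr _ _) _; rewrite rb.
have OZ : bigO (fun t => l1 (E t)) 1 Z.
  apply: bigO_le_near OF; eexists; exists 1; split; last first.
  - by move=> t _; rewrite -XF; exact: svd_truncation_error (trP t (X t)) rB.
  - by [].
  - by rewrite !mulr_ge0.
have OH : bigO (fun t => l1 (E t)) 1 H.
  apply: bigO_eq (bigOB OF OZ) => t.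
  by rewrite -XF /Z opprB addrC addrA subrK.
have [OG OGL] := bigO_pinv e0 ra rb uD
  (fun t => svd_truncation_factor (trP t (X t))) OH.
rewrite -/B -/L in OGL.
have OY : bigO (fun t => l1 (E t)) 0 Y.
  apply: bigO_eq (bigOD (bigO_weaken e0 (leq0n 1) OH) (bigO_cst B)) => t.
  by rewrite subrK.
have YGZ t : Y t *m G t *m Z t = 0.
  have [_ _ YGT _] := pinvP (Y t).
  by rewrite -YGT trmx_mul -mulmxA (svd_truncation_orth (trP t (X t))) mulmx0.
pose Ol t := pinv a *m (1%:M - Y t *m G t).
have OOl : bigO (fun t => l1 (E t)) 1 Ol.
  have O1 : bigO (fun t => l1 (E t)) 0 (fun t => 1%:M - Y t *m G t).
    exact (bigOB (bigO_cst _) (bigOM OY OG)).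
  (* Since a^+ = D b L and G (1 - Y G) = 0, a^+ (1 - Y G) = - D b (G - L)(1 - Y G). *)
  apply: bigO_eq (bigON (bigOM (bigOM (bigO_cst (D *m b)) OGL) O1)) => t.
  have [_ GYG _ _] := pinvP (Y t).
  have paE : pinv a = D *m b *m L.
    by rewrite LE !mulmxA -(mulmxA D) pb1 mulmx1 mulmxV// mul1mx.
  rewrite -mulmxA mulmxBl -[pinv (Y t) *m _]/(G t *m _).
  have -> : G t *m (1%:M - Y t *m G t) = 0.
    by rewrite mulmxBr mulmx1 mulmxA GYG subrr.
  by rewrite sub0r mulmxN opprK /Ol paE mulmxA.
pose Or t := (1%:M - G t *m Y t) *m pinv b.
have OOr : bigO (fun t => l1 (E t)) 1 Or.
  have O1 : bigO (fun t => l1 (E t)) 0 (fun t => 1%:M - G t *m Y t).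
    exact (bigOB (bigO_cst _) (bigOM OG OY)).
  apply: bigO_eq (bigON (bigOM (bigOM O1 OGL) (bigO_cst (a *m D)))) => t.
  have [_ GYG _ _] := pinvP (Y t).
  have pbE : pinv b = L *m (a *m D).
    by rewrite LE !mulmxA -(mulmxA _ _ a) pa1 mulmx1 -mulmxA mulVmx// mulmx1.
  rewrite mulmxBr -[(1%:M - G t *m Y t) *m pinv (Y t)]/(_ *m G t).
  have -> : (1%:M - G t *m Y t) *m G t = 0.
    by rewrite mulmxBl mul1mx GYG subrr.
  by rewrite sub0r mulNmx opprK /Or pbE !mulmxA.
pose W t := Ol t *m H t *m pinv b + pinv a *m H t *m Or t
  + Ol t *m Z t *m pinv b + pinv a *m (H t *m G t *m H t) *m pinv b.
have OW : bigO (fun t => l1 (E t)) 2 W.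
  apply: bigOD; [apply: bigOD; [apply: bigOD|]|].
  - exact (bigOM (bigOM OOl OH) (bigO_cst _)).
  - exact (bigOM (bigOM (bigO_cst _) OH) OOr).
  - exact (bigOM (bigOM OOl OZ) (bigO_cst _)).
  - exact (bigOM (bigOM (bigO_cst _) (bigOM (bigOM OH OG) OH)) (bigO_cst _)).
have O1 : bigO (fun t => l1 (E t)) 2
    (fun t => E t *m P *m (G t - L) *m (S^T *m M)).
  exact (bigOM (bigOM (bigOM OE (bigO_cst _)) OGL) (bigO_cst _)).
have O2 : bigO (fun t => l1 (E t)) 2
    (fun t => M *m P *m (G t - L) *m S^T *m E t).
  exact (bigOM (bigOM (bigOM (bigO_cst _) OGL) (bigO_cst _)) OE).
have O3 : bigO (fun t => l1 (E t)) 2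
    (fun t => E t *m P *m G t *m S^T *m E t).
  exact (bigOM (bigOM (bigOM (bigOM OE (bigO_cst _)) OG) (bigO_cst _)) OE).
have O4 := bigOM (bigOM (bigO_cst U) OW) (bigO_cst V^T).
(* The remainder splits exactly: [O1] and [O2] replace G by L in the terms linear in E, [O3] is the
   term with two explicit factors E, and [O4] is U W V^T, what M P G S^T M leaves. *)
apply: bigO_eq (bigOD (bigOD (bigOD O1 O2) O3) O4) => t.
have [YGY _ _ _] := pinvP (Y t).
have MP : M *m P = U *m (D *m b) by rewrite ME bE !mulmxA.
have SM : S^T *m M = a *m D *m V^T by rewrite ME aE !mulmxA.
have eV : E t *m P *m L *m (S^T *m M) = E t *m Pi_V P V.
  rewrite SM LE /Pi_V -bE !mulmxA -(mulmxA _ _ a) pa1 mulmx1 -(mulmxA _ _ D).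
  by rewrite mulVmx// mulmx1.
have eU : M *m P *m L *m S^T *m E t = Pi_U S U *m E t.
  rewrite MP LE /Pi_U -aE !mulmxA -(mulmxA _ b) pb1 mulmx1 -(mulmxA U) mulmxV//.
  by rewrite mulmx1.
have eUV : Pi_U S U *m E t *m Pi_V P V = U *m (pinv a *m F t *m pinv b) *m V^T.
  by rewrite /Pi_U /Pi_V -aE -bE /F !mulmxA.
have WE : W t = pinv a *m (B *m G t *m B - B + F t) *m pinv b.
  have FE : F t = H t + Z t by rewrite -XF /H /Z [RHS]addrC addrA subrK.
  have BYH : B = Y t - H t by rewrite /H subKr.
  rewrite FE {1 2 3}BYH (inner_inverse_expansion (H t) YGY (YGZ t)).
  have dist (A1 A2 A3 A4 : 'M[R]_(s, c)) : pinv a *m (A1 + A2 + A3 + A4) *m pinv b =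
      pinv a *m A1 *m pinv b + pinv a *m A2 *m pinv b + pinv a *m A3 *m pinv b
      + pinv a *m A4 *m pinv b by rewrite !(mulmxDr, mulmxDl).
  by rewrite dist /W /Ol /Or !mulmxA.
have e4 : M *m P *m G t *m (S^T *m M) - M + Pi_U S U *m E t *m Pi_V P V =
    U *m W t *m V^T.
  rewrite WE eUV MP SM !(mulmxDr, mulmxDl); congr (_ + _ + _).
    rewrite /B !mulmxA -(mulmxA U (pinv a)) pa1 mulmx1 -!mulmxA; congr (_ *m _).
    by rewrite (mulmxA b (pinv b)) pb1 mul1mx.
  rewrite mulmxN mulNmx mulmxN mulNmx; congr (- _).
  by rewrite /B !mulmxA -(mulmxA U (pinv a)) pa1 mulmx1 -(mulmxA _ b) pb1 mulmx1.
rewrite -e4 /oblique_tangent_proj -eV -eU.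
rewrite /Phi -/(X t) -/(Y t) -/(G t) !(mulmxDr, mulmxDl, mulmxN, mulNmx) !mulmxA.
by apply/matrixP => i j; rewrite !mxE; ring.
Qed.

(** * Independence of the choice of SVD *)

(** Here a and a' have the same range, so a a^+ = a' a'^+; then Q a^+ = a'^+ a' Q a^+ = a'^+ a a^+ =
    a'^+. *)
Lemma Pi_U_range m s r (S : 'M[R]_(m, s)) (U U' : 'M[R]_(m, r)) Q Q' :
  U = U' *m Q -> U' = U *m Q' -> \rank (S^T *m U) = r -> \rank (S^T *m U') = r ->
  Pi_U S U = Pi_U S U'.
Proof.
move=> UQ UQ' ra ra'; have [a aE] : exists a, a = S^T *m U by eexists.
have [a' aE'] : exists a', a' = S^T *m U' by eexists.
rewrite -aE' in ra'; rewrite /Pi_U -aE -aE'.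
have [aa _ aT _] := pinvP a; have [aa' paE' aT' _] := pinvP a'.
have aQ : a = a' *m Q by rewrite aE aE' UQ mulmxA.
have aQ' : a' = a *m Q' by rewrite aE aE' UQ' mulmxA.
have projE : a *m pinv a = a' *m pinv a'.
  have h1 : a *m pinv a *m (a' *m pinv a') = a' *m pinv a'.
    by rewrite {1}aQ' !mulmxA aa -aQ'.
  have h2 : a' *m pinv a' *m (a *m pinv a) = a *m pinv a.
    by rewrite {1}aQ !mulmxA aa' -aQ.
  by rewrite -h2 -[LHS]trmxK trmx_mul aT aT' h1 aT'.
congr (_ *m _).
rewrite {1}UQ -[U' *m Q]mulmx1 -!mulmxA; congr (_ *m _).
rewrite mul1mx -[Q in LHS]mul1mx -(pinv_mulmx_full ra') -!mulmxA (mulmxA a') -aQ.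
by rewrite projE mulmxA paE'.
Qed.

Lemma compact_svd_range m n r (M : 'M[R]_(m, n)) (U U' : 'M[R]_(m, r)) d d' V V' :
  compact_svd M U d V -> compact_svd M U' d' V' -> exists Q, U = U' *m Q.
Proof.
move=> [UU VV _ d0 ME] [_ _ _ _ ME'].
have uD : diag_mx d \in unitmx.
  rewrite unitmxE det_diag unitfE; apply/prodf_neq0 => i _.
  by rewrite gt_eqF.
exists (diag_mx d' *m V'^T *m V *m invmx (diag_mx d)).
rewrite !mulmxA -ME' ME -(mulmxA _ V^T) VV mulmx1 -(mulmxA U) mulmxV//.
by rewrite mulmx1.
Qed.

Lemma compact_svd_tr m n r (M : 'M[R]_(m, n)) (U : 'M[R]_(m, r)) d V :
  compact_svd M U d V -> compact_svd M^T V d U.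
Proof.
move=> [UU VV dle d0 ->]; split=> //.
by rewrite !trmx_mul trmxK tr_diag_mx mulmxA.
Qed.

Lemma Pi_V_tr n c r (P : 'M[R]_(n, c)) (V : 'M[R]_(n, r)) :
  Pi_V P V = (Pi_U P V)^T.
Proof. by rewrite /Pi_V /Pi_U !trmx_mul -pinv_tr trmx_mul !trmxK mulmxA. Qed.

(** Two SVDs of M share the column spaces of their factors, on which alone the oblique projectors
    depend. A bound found for one SVD thus serves all. *)
Lemma oblique_tangent_proj_svd m n s c r (M : 'M[R]_(m, n)) (S : 'M[R]_(m, s))
    (P : 'M[R]_(n, c)) (U U' : 'M[R]_(m, r)) d d' (V V' : 'M[R]_(n, r)) :
  compact_svd M U d V -> compact_svd M U' d' V' ->
  \rank (S^T *m U) = r -> \rank (V^T *m P) = r ->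
  \rank (S^T *m U') = r -> \rank (V'^T *m P) = r ->
  oblique_tangent_proj S P U V =1 oblique_tangent_proj S P U' V'.
Proof.
move=> h h' ra rb ra' rb' E.
have hT := compact_svd_tr h; have hT' := compact_svd_tr h'.
have [Q UQ] := compact_svd_range h h'; have [Q' UQ'] := compact_svd_range h' h.
have [W VW] := compact_svd_range hT hT'; have [W' VW'] := compact_svd_range hT' hT.
rewrite /oblique_tangent_proj !Pi_V_tr (Pi_U_range UQ UQ')//.
by rewrite (Pi_U_range VW VW')// -mxrank_tr trmx_mul trmxK.
Qed.

End Perturbation.

(** * Uniform constants and passage to the norm [N] *)

Theorem corollary3p1 (R : realType) (m n s c r : nat)
    (N : 'M[R]_(m, n) -> R) (M : 'M[R]_(m, n))
    (S : 'M[R]_(m, s)) (P : 'M[R]_(n, c)) :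
  (1 <= r)%N -> is_norm N -> selection_mx S -> selection_mx P ->
  exists C delta : R, 0 < delta /\
    forall (U : 'M[R]_(m, r)) (sigma : 'rV[R]_r) (V : 'M[R]_(n, r)),
      compact_svd M U sigma V ->
      \rank (S^T *m U) = r -> \rank (V^T *m P) = r ->
    forall tr : 'M[R]_(s, c) -> 'M[R]_(s, c), truncation_rule r tr ->
    forall E : 'M[R]_(m, n), N E < delta ->
      N (Phi tr S P (M + E) - M - oblique_tangent_proj S P U V E)
        <= C * N E ^+ 2 /\
      N (Phi tr S P (M + E) - M)
        <= N (oblique_tangent_proj S P U V E) + C * N E ^+ 2.
Proof.
move=> _ hN _ _.
pose svd U sigma V := [/\ @compact_svd R m n r M U sigma V,
  \rank (S^T *m U) = r & \rank (V^T *m P) = r].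
(* Without an admissible SVD the claim is vacuous and any constants do; otherwise one SVD is fixed
   to produce them. *)
case: (pselect (exists U sigma V, svd U sigma V)) => [|nosvd]; last first.
  exists 0, 1; split=> // U sigma V h ra rb; case: nosvd.
  by exists U, sigma, V.
move=> [U0 [sigma0 [V0 [h0 ra0 rb0]]]].
(* Including the truncation rule in the parameter makes the constants uniform over all rules. *)
pose T :=
  ({tr : 'M[R]_(s, c) -> 'M[R]_(s, c) | truncation_rule r tr} * 'M[R]_(m, n))%type.
have [C [delta [C0 delta0 bound]]] := @Phi_expansion R T m n s c r M U0 sigma0 V0
  S P snd (fun t => sval t.1) h0 ra0 rb0 (fun t => svalP t.1).
have [K1 K1_gt0 NK1] := norm_le_l1 hN; have [K2 K2_gt0 NK2] := l1_le_norm hN.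
exists (K1 * (C * K2 ^+ 2)), (delta / K2); split; first exact: divr_gt0.
move=> U sigma V h ra rb tr trP E NE.
rewrite (oblique_tangent_proj_svd h h0)//.
set X := Phi _ _ _ _ - M; set I := oblique_tangent_proj _ _ _ _ _.
have XI : N (X - I) <= K1 * (C * K2 ^+ 2) * N E ^+ 2.
  have lE : l1 E < delta.
    by apply: le_lt_trans (NK2 E) _; rewrite mulrC -ltr_pdivlMr.
  apply: le_trans (NK1 _) _; rewrite -mulrA (ler_pM2l K1_gt0).
  apply: le_trans (bound (exist _ tr trP, E) lE) _.
  rewrite -mulrA ler_wpM2l// -exprMn lerXn2r ?nnegrE ?l1_ge0//=.
  by rewrite mulr_ge0 ?(norm_ge0 hN) ?ltW.
split=> //; apply: le_trans (_ : N I + N (X - I) <= _); last by rewrite lerD2l.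
by case: hN => _ _ ND; rewrite -[X in leLHS](subrK I) addrC.
Qed.
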